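(* Let $k,m\in\mathbb{N}$, let $\Phi$ be a nonempty set of functions from $\{1,\ldots,k\}$ onto $\{1,\ldots,m\}$, let $I_1,\ldots,I_m$ be infinite sets (not necessarily disjoint), and for every $\varphi\in\Phi$ let $X^\varphi\subseteq I_{\varphi(1)}\times\cdots\times I_{\varphi(k)}$. Then the following properties are equivalent: (1) There exist pairwise distinct non-principal ultrafilters $\mathcal{U}_\ell$ on $I_\ell$ for $\ell=1,\ldots,m$ such that for every $\varphi\in\Phi$ one has $X^\varphi\in\mathcal{U}_{\varphi(1)}\otimes\cdots\otimes\mathcal{U}_{\varphi(k)}$. (2) There exist sequences $(a_{\ell,n})_{n\in\mathbb{N}}$ in $I_\ell$ for $\ell=1,\ldots,m$ such that: (a) $a_{\ell,n}\ne a_{\ell',n'}$ whenever $(\ell,n)\ne(\ell',n')$ (i.e. every sequence $(a_{\ell,n})_{n\in\mathbb{N}}$ is 1-1 and the ranges $\{a_{\ell,n}\mid n\in\mathbb{N}\}$ are pairwise disjoint); (c) for every $\varphi\in\Phi$ and for every $(j_1,\ldots,j_k)\in\mathbb{N}^k$ such that $j_1\le\cdots\le j_k$ and such that $j_s<j_{s+1}$ whenever $1\le s<k$ and $\varphi(s)\ge\varphi(s+1)$, one has $$(a_{\varphi(1),j_1},\ldots,a_{\varphi(k),j_k})\in X^\varphi.$$ Moreover, (b) in (2) the sequences can be taken so that, in addition, $(a_{\ell,n})_{n}$ is (strictly) increasing for every $\ell$ with $I_\ell=\mathbb{N}$.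
   Context: $\mathbb{N}=\{1,2,3,\ldots\}$. For ultrafilters $\mathcal{U}$ on $I$ and $\mathcal{V}$ on $J$, the tensor product $\mathcal{U}\otimes\mathcal{V}$ is the ultrafilter on $I\times J$ defined by: $X\in\mathcal{U}\otimes\mathcal{V}$ if and only if $\{i\in I\mid X_i\in\mathcal{V}\}\in\mathcal{U}$, where $X_i=\{j\in J\mid (i,j)\in X\}$. The operation $\otimes$ is associative (identifying $I\times(J\times K)$ and $(I\times J)\times K$), so iterated tensor products are well defined; for $k=1$ the product is just the single ultrafilter. *)

(* Defs.v *)
From mathcomp Require Import all_boot all_order.
From mathcomp Require Export boolp classical_sets functions cardinality filter.

Set Implicit Arguments.
Unset Strict Implicit.
Unset Printing Implicit Defensive.

Local Open Scope classical_set_scope.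

(* Positive integers k are written k.+1, so that {1, ..., k} is 'I_k.+1, and
   sequences indexed by {1, 2, 3, ...} are reindexed from 0. *)

(* [fun i => [set j | X (i, j)]] is the family of sections X_i. *)
Definition tensor (I J : Type) (U : set_system I) (V : set_system J) :
    set_system (I * J) :=
  [set X | U [set i | V [set j | X (i, j)]]].

(* J_1 * (J_2 * (... * J_k)), which is J_1 itself when k = 1. *)
Fixpoint nprod (k : nat) : ('I_k.+1 -> Type) -> Type :=
  match k with
  | 0 => fun J => J ord0
  | k'.+1 => fun J => (J ord0 * nprod (fun s : 'I_k'.+1 => J (lift ord0 s)))%type
  end.

Fixpoint mk_nprod (k : nat) :
    forall J : 'I_k.+1 -> Type, (forall s, J s) -> nprod J :=
  match k with
  | 0 => fun J f => f ord0
  | k'.+1 => fun J f =>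
      (f ord0, mk_nprod (fun s : 'I_k'.+1 => f (lift ord0 s)))
  end.

Fixpoint ntensor (k : nat) :
    forall J : 'I_k.+1 -> Type,
      (forall s, set_system (J s)) -> set_system (nprod J) :=
  match k with
  | 0 => fun J U => U ord0
  | k'.+1 => fun J U =>
      tensor (U ord0) (ntensor (fun s : 'I_k'.+1 => U (lift ord0 s)))
  end.

Definition nonprincipal (I : Type) (U : set_system I) : Prop :=
  forall x : I, U <> principal_filter x.

(* A set system on the subset I of T, read as a family of subsets of T; this is
   what allows comparing ultrafilters on distinct, possibly overlapping sets. *)
Definition as_family (T : Type) (I : set T) (U : set_system I) : set (set T) :=
  [set set_val @` A | A in U].

Section Sequences.
Variables (T : Type) (k m : nat) (I : 'I_m.+1 -> set T).

Definition disjoint_injective (a : forall l, nat -> I l) : Prop :=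
  forall l l' n n', (l, n) <> (l', n') ->
    set_val (a l n) <> set_val (a l' n').

Definition admissible (phi : 'I_k.+1 -> 'I_m.+1) (j : 'I_k.+1 -> nat) : Prop :=
  (forall s t : 'I_k.+1, s <= t -> j s <= j t) /\
  (forall s t : 'I_k.+1, t = s.+1 :> nat -> phi t <= phi s -> j s < j t).

Definition sequences_in (Phi : set ('I_k.+1 -> 'I_m.+1))
    (X : forall phi : 'I_k.+1 -> 'I_m.+1, set (nprod (fun s => I (phi s))))
    (a : forall l, nat -> I l) : Prop :=
  forall phi, Phi phi -> forall j, admissible phi j ->
    X phi (mk_nprod (fun s => a (phi s) (j s))).

(* [iota] exhibits a copy of the natural numbers inside T, the image of i
   standing for the positive integer i + 1. *)
Definition increasing_on_nat (iota : nat -> T) (a : forall l, nat -> I l) :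
    Prop :=
  forall l, I l = range iota ->
    exists b : nat -> nat,
      (forall n p, n < p -> b n < b p) /\
      (forall n, set_val (a l n) = iota (b n)).

End Sequences.

(* Main.v *)
Require Import Defs.
From mathcomp Require Import all_boot all_order.
From mathcomp Require Import boolp classical_sets functions cardinality filter.

Local Open Scope classical_set_scope.

(** Order the index pairs [(l, n)] as the times [N = n * (m + 1) + l].  The
    admissible tuples [j] for [phi] are those for which the times of the
    entries [(phi s, j s)] are strictly increasing, and this turns the theorem
    into a Ramsey-type statement about a single sequence indexed by time.

    From ultrafilters to sequences, choose at each time [N] an element of
    [I l], where [l] is the label [N mod (m + 1)].  Say that a prefix
    [(x_1, ..., x_s)] of elements already chosen at increasing times is large
    for [phi] when the section of [X phi] over it belongs to the tensor product
    of the remaining ultrafilters.  By definition of the tensor product, a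
    large prefix remains large for almost all choices of [x_{s+1}], in the
    sense of the ultrafilter [U (phi (s+1))].  Only finitely many [phi] and
    finitely many prefixes matter at time [N], so almost every choice is
    [safe], i.e. keeps large every large prefix that it extends
    ([safe_large]); almost every choice also differs from the earlier elements,
    by non-principality ([fresh]).  Making a choice of this kind at every time
    gives the sequences: the empty prefix is large, so by induction
    ([safe_mk_nprod]) every tuple picked at increasing times with the right
    labels is in [X phi].

    From sequences to ultrafilters, push one ultrafilter containing all the
    tails of the natural numbers forward along every sequence: all
    strictly increasing [j] are admissible, which is enough for membership in
    the tensor product ([ntensor_fmap]).  The disjoint ranges separate the
    images.

    Finally, (c) is inherited by common subsequences ([sequences_in_sub]), and
    finitely many injective sequences of natural numbers, which all tend to
    infinity, have a common choice of indices along which they all increase. *)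

(** * Auxiliary facts on choice and filters *)

(** A choice that depends on all the earlier ones: iterate a selector of [G] on
    the list of the elements chosen so far. *)
Lemma history_choice (P : Type) (G : seq P -> set P) :
  (forall h, G h !=set0) -> exists c : nat -> P, forall N, G (mkseq c N) (c N).
Proof.
move=> /(_ _)/cid-/all_sig[g gG].
pose hist N := iter N (fun h => rcons h (g h)) [::].
pose c N := g (hist N).
exists c => N; suff -> : mkseq c N = hist N by exact: gG.
by elim: N => [|N IH] //; rewrite mkseqS IH.
Qed.

Section Filters.
Context {I J : Type}.

Lemma fmap_ultra (f : I -> J) (W : set_system I) :
  UltraFilter W -> UltraFilter (fmap f W).
Proof.
move=> FW; split; first exact: fmap_proper_filter.
move=> G GP WG; apply/seteqP; split=> [A GA|]; last exact: WG.
have [//|nA] := in_ultra_setVsetC (f @^-1` A) FW.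
have /WG GnA : fmap f W (~` A) by [].
by have [y []] := filter_ex (filterI GA GnA).
Qed.

Lemma nonprincipal_setC1 (U : set_system I) :
  UltraFilter U -> nonprincipal U -> forall x, U (~` [set x]).
Proof.
move=> UU npU x; have [Ux|//] := in_ultra_setVsetC [set x] UU.
case: (npU x); apply/esym/max_filter; first exact: principal_filter_proper.
by move=> A UA; have [y [-> Ay]] := filter_ex (filterI Ux UA);
  apply/principal_filterP.
Qed.
End Filters.

(** Each value is taken at most once, so it is avoided from some index on. *)
Lemma injective_eventually_ge (b : nat -> nat) :
  injective b -> forall B, \oo [set n | B <= b n].
Proof.
move=> b_inj; elim=> [|B IH]; first exact: filterS filterT.
have [[n0 bn0]|nB] := pselect (exists n, b n = B); last first.
  apply: filterS IH => n /=; rewrite leq_eqVlt => /predU1P[e|//].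
  by case: nB; exists n.
have gt_n0 : \oo [set n | n0 < n] by exists n0.+1.
apply: filterS (filterI IH gt_n0) => n /= [].
rewrite leq_eqVlt => /predU1P[|//]; rewrite -bn0 => /b_inj ->.
by rewrite ltnn.
Qed.

(** * Safe choices *)

Section CylinderFilter.
Context {L : Type} {J : L -> Type} (U : forall l, set_system (J l)).
Context {UF : forall l, ProperFilter (U l)}.

(** The filter generated by the preimages of the members of [U l] under the
    projection to [J l].  Choosing a whole family [forall l, J l] at each time,
    of which just one coordinate will be used, avoids sequences whose type
    varies with time. *)
Definition cylinder (l : L) : set_system (forall l, J l) :=
  [set A | U l [set x | forall z : forall l, J l, z l = x -> A z]].

Lemma cylinder_filter l : ProperFilter (cylinder l).
Proof.
apply: Build_ProperFilter_ex => [A lA|].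
  have [x xA] := @filter_ex _ (U l) _ _ lA.
  (* The other coordinates only need some value, which exists since each
     [U l'] is proper. *)
  have inhJ l' : {y : J l' | forall e : l = l', y = ecast i (J i) e x}.
    apply: cid; have [e|ne] := pselect (l = l').
      by exists (ecast i (J i) e x) => e'; rewrite (Prop_irrelevance e e').
    by have [y _] := filter_ex (@filterT _ (U l') _); exists y.
  exists (fun l' => sval (inhJ l')); apply: xA.
  exact: (svalP (inhJ l) erefl).
split.
- exact: (@filterS _ (U l)) filterT.
- move=> A B lA lB; apply: (filterS _ (@filterI _ (U l) _ _ _ lA lB)).
  by move=> x [xA xB] z zx; split; [exact: xA|exact: xB].
- by move=> A B AB; apply: (@filterS _ (U l)) => x xA z /xA /AB.
Qed.

Lemma cylinderP l (B : set (J l)) (A : set (forall l, J l)) :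
  U l B -> (forall z, B (z l) -> A z) -> cylinder l A.
Proof.
by move=> UB BA; apply: filterS UB => x Bx z zx; apply: BA; rewrite zx.
Qed.

(** Given the history [h], the choices [x] for label [l] that keep large every
    large prefix they extend.  The first conjunct treats the empty prefix, and
    the second one the prefixes starting with the element [i] of the history,
    by recursion on the section over that element.  Prefixes may list elements
    of [h] in any order, even with repetitions: this keeps the recursion
    simple, and there are still finitely many of them. *)
Fixpoint safe (k : nat) : forall phi : 'I_k.+1 -> L,
    set (nprod (fun s => J (phi s))) -> L -> seq (forall l, J l) -> set (forall l, J l) :=
  match k with
  | 0 => fun (phi : 'I_1 -> L) X l h => [set x : forall l, J l |
      phi ord0 = l -> U (phi ord0) X -> (X : set (J (phi ord0))) (x (phi ord0))]
  | k'.+1 => fun (phi : 'I_k'.+2 -> L)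
      (X : set (J (phi ord0) * nprod (fun s => J (phi (lift ord0 s))))) l h =>
      [set x : forall l, J l | phi ord0 = l ->
        ntensor (fun s => U (phi s)) (X : set (nprod (fun s => J (phi s)))) ->
        ntensor (fun s => U (phi (lift ord0 s)))
          [set y | X (x (phi ord0), y)]] `&`
      [set x | forall i : 'I_(size h), safe k' (fun s => phi (lift ord0 s))
        [set y | X (tnth (in_tuple h) i (phi ord0), y)] l h x]
  end.

(** [safe] is a finite intersection of sets that are either everything (when the
    prefix is not large, or has another label coming next) or given by the
    definition of the tensor product. *)
Lemma safe_large k (phi : 'I_k.+1 -> L) (X : set (nprod (fun s => J (phi s))))
  l h : cylinder l (safe k phi X l h).
Proof.
have CF := cylinder_filter l.
have cylU l' (A : Prop) (B : set (J l')) : (A -> U l' B) ->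
    cylinder l [set x | l' = l -> A -> B (x l')].
  move=> UB; have [e|ne] := pselect (l' = l); last first.
    by apply: filterS filterT => x _ /ne.
  subst l; have [/UB UB'|nA] := pselect A; last first.
    by apply: filterS filterT => x _ _ /nA.
  by apply: (cylinderP _ _ _ UB') => z Bz _ _.
elim: k phi X => [|k IH] phi X /=; first exact: (cylU _ (U _ X) X).
apply: filterI; last first.
  by apply: (@filter_forall _ _ _ (cylinder l)) => i; exact: IH.
exact: (cylU _ (ntensor (fun s => U (phi s)) X)
  [set y | ntensor (fun s => U (phi (lift ord0 s))) [set z | X (y, z)]]).
Qed.

(** If the choices are safe from time [N0] on, so are they for the section of
    [X] over the first entry, but only from the time after [p ord0] on: this is
    why the bound [N0] is needed in the induction. *)
Lemma safe_mk_nprod (lab : nat -> L) (c : nat -> forall l, J l)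
    {k} (phi : 'I_k.+1 -> L) (X : set (nprod (fun s => J (phi s)))) N0 :
  ntensor (fun s => U (phi s)) X ->
  (forall N, N0 <= N -> safe k phi X (lab N) (mkseq c N) (c N)) ->
  forall p : 'I_k.+1 -> nat, N0 <= p ord0 ->
  (forall s, lab (p s) = phi s) ->
  (forall s t : 'I_k.+1, t = s.+1 :> nat -> p s < p t) ->
  X (mk_nprod (fun s => c (p s) (phi s))).
Proof.
elim: k phi X N0 => [|k IH] phi X N0 UX safeX p N0p labp ltp /=.
  exact: (safeX _ N0p).
have [/(_ (esym (labp _)) UX) UX' _] := safeX _ N0p.
pose p' (s : 'I_k.+1) := p (lift ord0 s).
apply: (IH (fun s => phi (lift ord0 s)) [set y | X (c (p ord0) (phi ord0), y)]
  (p ord0).+1 UX' _ p') => //.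
- move=> N ltN; have [_] := safeX N (leq_trans N0p (ltnW ltN)).
  have ltN' : p ord0 < size (mkseq c N) by rewrite size_mkseq.
  move=> /(_ (Ordinal ltN')).
  by rewrite (tnth_nth (c 0)) /= nth_mkseq.
- exact: ltp.
- by move=> s; exact: labp.
- by move=> s t ts; apply: ltp; rewrite !lift0 ts.
Qed.
End CylinderFilter.

(** * Images of an ultrafilter along sequences *)

(** The bound [N0] is what the entries already fixed impose on the next index;
    all large indices [n] are suitable, hence [W]-almost all. *)
Lemma ntensor_fmap (W : set_system nat) : Filter W -> \oo `<=` W ->
  forall k (J : 'I_k.+1 -> Type) (a : forall s, nat -> J s)
    (X : set (nprod J)) N0,
  (forall j : 'I_k.+1 -> nat, N0 <= j ord0 ->
     (forall s t : 'I_k.+1, s < t -> j s < j t) ->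
     X (mk_nprod (fun s => a s (j s)))) ->
  ntensor (fun s => fmap (a s) W) X.
Proof.
move=> FW ooW; elim=> [|k IH] J a X N0 XP /=.
  apply: ooW; exists N0 => // n /= N0n.
  by apply: (XP (fun=> n)) => // s t; rewrite !ord1.
rewrite /tensor /=; apply: ooW; exists N0 => // n /= N0n.
apply: (IH _ _ _ n.+1) => j ltnj ltj /=.
(* Put the index [n] in front of the indices [j] of the section. *)
pose j' (s : 'I_k.+2) := oapp j n (unlift ord0 s).
have j'0 : j' ord0 = n by rewrite /j' unlift_none.
have j'S s : j' (lift ord0 s) = j s by rewrite /j' liftK.
have jgt s : n < j s.
  have [->//|s0] := eqVneq s ord0.
  by apply: (ltn_trans ltnj); apply: ltj; rewrite lt0n.
have := XP j'; rewrite /= j'0.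
have -> : (fun s => a (lift ord0 s) (j' (lift ord0 s))) =
          (fun s => a (lift ord0 s) (j s)).
  by apply: functional_extensionality_dep => s; rewrite j'S.
apply => // s t; case: (unliftP ord0 s) => [s'|] ->;
  case: (unliftP ord0 t) => [t'|] ->; rewrite ?j'0 ?j'S //.
by rewrite !lift0 ltnS; exact: ltj.
Qed.

(** * Sequences versus ultrafilters *)

Section Sequences.
Context {T : Type} {k m : nat} {I : 'I_m.+1 -> set T}.
Context (Phi : set ('I_k.+1 -> 'I_m.+1)).
Context (X : forall phi : 'I_k.+1 -> 'I_m.+1, set (nprod (fun s => I (phi s)))).

Definition label (N : nat) : 'I_m.+1 := Ordinal (ltn_pmod N (ltn0Sn m)).

Lemma label_block n (l : 'I_m.+1) : label (n * m.+1 + l) = l.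
Proof. by apply: val_inj; rewrite /= modnMDl modn_small. Qed.

(** Equal consecutive values of [j] are allowed just when the label increases,
    so times increase in all cases. *)
Lemma admissible_block (phi : 'I_k.+1 -> 'I_m.+1) (j : 'I_k.+1 -> nat) :
  admissible phi j -> forall s t : 'I_k.+1, t = s.+1 :> nat ->
  j s * m.+1 + phi s < j t * m.+1 + phi t.
Proof.
move=> [lej ltj] s t ts.
have [ltst|lets] := ltnP (phi s) (phi t).
  by rewrite -addnS leq_add // leq_mul2r lej ?ts ?leqnSn ?orbT.
apply: (@leq_trans ((j s).+1 * m.+1)); first by rewrite mulSn addnC ltn_add2r.
by rewrite (leq_trans _ (leq_addr _ _)) // leq_mul2r (ltj s t ts lets) orbT.
Qed.

(** The sets [I l] may overlap, so an element of [I l] has to avoid earlier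
    elements of all of them: this is why [t] ranges over [T]. *)
Lemma fresh (U : forall l, set_system (I l)) :
  (forall l, UltraFilter (U l)) -> (forall l, nonprincipal (U l)) ->
  forall l (t : T), U l [set x | set_val x <> t].
Proof.
move=> UU npU l t.
have [[y yt]|nt] := pselect (exists y : I l, set_val y = t).
  apply: filterS (nonprincipal_setC1 (U l) _ (npU l) y) => x xy xt.
  by apply: xy; apply: val_inj; exact: etrans xt (esym yt).
by apply: filterS filterT => x _ xt; apply: nt; exists x.
Qed.

Lemma ultrafilters_sequences (U : forall l, set_system (I l)) :
  (forall l, UltraFilter (U l)) -> (forall l, nonprincipal (U l)) ->
  (forall phi, Phi phi -> ntensor (fun s => U (phi s)) (X phi)) ->
  exists a : forall l, nat -> I l, disjoint_injective a /\ sequences_in Phi X a.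
Proof.
move=> UU npU UX.
pose P := forall l, I l.
pose new l (h : seq P) : set P :=
  [set x : P | forall (i : 'I_(size h)) l',
    set_val (x l) <> set_val (tnth (in_tuple h) i l')].
pose good l (h : seq P) : set P := [set x : P |
  forall phi : {ffun 'I_k.+1 -> 'I_m.+1}, safe U k phi (X phi) l h x].
have [h|c cP] := @history_choice P (fun h =>
    new (label (size h)) h `&` good (label (size h)) h).
  have CF : ProperFilter (cylinder U (label (size h))) by exact: cylinder_filter.
  apply: (@filter_ex _ (cylinder U (label (size h)))); apply: filterI.
    apply: (@filter_forall _ _ _ (cylinder U _)) => i.
    apply: (@filter_forall _ _ _ (cylinder U _)) => l'.
    exact: (cylinderP U _ _ _
      (fresh U UU npU _ (set_val (tnth (in_tuple h) i l'))) (fun z => id)).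
  apply: (@filter_forall _ _ _ (cylinder U _)) => phi.
  exact: safe_large.
exists (fun (l : 'I_m.+1) n => c (n * m.+1 + l) l); split.
  suff ltc N N' l l' : label N = l -> label N' = l' -> N' < N ->
      set_val (c N l) <> set_val (c N' l').
    move=> l l' n n' ne.
    have [lt|lt|e] := ltngtP (n * m.+1 + l) (n' * m.+1 + l').
    - by apply: nesym; apply: ltc lt; rewrite label_block.
    - by apply: ltc lt; rewrite label_block.
    - exfalso; apply: ne.
      have el : l = l' by rewrite -(label_block n l) e label_block.
      by move: e; rewrite el => /addIn /eqP; rewrite eqn_pmul2r // => /eqP ->.
  move=> <- <- lt; have [+ _] := cP N; rewrite size_mkseq.
  have lt' : N' < size (mkseq c N) by rewrite size_mkseq.
  move=> /(_ (Ordinal lt') (label N')).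
  by rewrite (tnth_nth (c 0)) /= nth_mkseq.
move=> phi Phi_phi j adm.
(* Finite functions index the intersection of the safety conditions, as
   functions do not form a finite type. *)
have [f fE] : exists f : {ffun 'I_k.+1 -> 'I_m.+1}, phi = f.
  by exists (finfun phi); apply/funext => s; rewrite ffunE.
subst phi.
apply: (safe_mk_nprod U label c f (X f) 0 (UX _ Phi_phi) _
  (fun s => j s * m.+1 + f s)) => //.
- by move=> N _; have [_] := cP N; rewrite size_mkseq; exact.
- by move=> s; exact: label_block.
- exact: admissible_block.
Qed.

Lemma sequences_ultrafilters (a : forall l, nat -> I l) :
  disjoint_injective a -> sequences_in Phi X a ->
  exists U : forall l, set_system (I l),
      [/\ forall l, UltraFilter (U l),
          forall l, nonprincipal (U l),
          forall l l', l <> l' -> as_family (U l) <> as_family (U l') &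
          forall phi, Phi phi -> ntensor (fun s => U (phi s)) (X phi)].
Proof.
move=> inja aX.
have [W [UW ooW]] := ultraFilterLemma eventually_filter.
exists (fun l => fmap (a l) W); split.
- by move=> l; exact: fmap_ultra.
- move=> l x Ux.
  have Wx : W (a l @^-1` [set x]).
    by have /principal_filterP : [set x] x by []; rewrite -Ux.
  have [n nx] := filter_ex Wx.
  have Wn : W [set p | n < p] by apply: ooW; exists n.+1.
  have [p [px ltnp]] := filter_ex (filterI Wx Wn).
  apply: (inja l l n p); last by rewrite nx px.
  by move=> [e]; rewrite e /= ltnn in ltnp.
(* Membership of the range of [a l] distinguishes the two families. *)
- move=> l l' ne e.
  have : as_family (fmap (a l) W) (set_val @` range (a l)).
    exists (range (a l)) => //.
    by apply: (@filterS _ W _ _ _ _ filterT) => n _; exists n.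
  rewrite e => -[A WA Ae].
  have [n An] := @filter_ex _ W _ _ WA.
  have : (set_val @` A) (set_val (a l' n)) by exists (a l' n).
  rewrite Ae => -[_ [p _ <-]]; by apply: inja => -[] /ne.
- move=> phi Phi_phi; apply: (ntensor_fmap W _ ooW _ _ _ _ 0) => j _ ltj.
  apply: aX => //; split=> s t; last by move=> ts _; apply: ltj; rewrite ts.
  rewrite leq_eqVlt => /predU1P[/val_inj -> //|/ltj /ltnW].
  exact.
Qed.

Lemma sequences_in_sub (a : forall l, nat -> I l) (u : nat -> nat) :
  {homo u : n p / n < p} -> sequences_in Phi X a ->
  sequences_in Phi X (fun l n => a l (u n)).
Proof.
move=> ltu aX phi Phi_phi j [lej ltj].
apply: (aX phi Phi_phi (fun s => u (j s))); split.
  by move=> s t /lej; exact: (ltnW_homo ltu).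
by move=> s t ts /(ltj _ _ ts) /ltu.
Qed.

Lemma increasing_subsequences (a : forall l, nat -> I l) (iota : nat -> T) :
  disjoint_injective a -> sequences_in Phi X a ->
  exists a : forall l, nat -> I l,
    [/\ disjoint_injective a, increasing_on_nat iota a & sequences_in Phi X a].
Proof.
move=> inja aX.
have /choice[b bE] : forall l, exists b : nat -> nat,
    I l = range iota -> forall n, set_val (a l n) = iota (b n).
  move=> l; have [Il|nI] := pselect (I l = range iota); last by exists id => /nI.
  have /choice[b bE] : forall n, exists p, set_val (a l n) = iota p.
    move=> n; have : range iota (set_val (a l n)).
      by rewrite -[X in X _]Il; exact: set_valP.
    by move=> [p _ <-]; exists p.
  by exists b.
have bdvg l : I l = range iota -> forall B, \oo [set n | B <= b l n].
  move=> Il; apply: injective_eventually_ge => n p enp; apply: contrapT => ne.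
  by apply: (inja l l n p); [move=> -[]|rewrite !bE // enp].
(* The same indices must serve all [l] at once; the relation is transitive, so
   comparing consecutive indices suffices. *)
pose lt_all p q := p < q /\ forall l, I l = range iota -> b l p < b l q.
have /choice[next nextP] : forall p, exists q, lt_all p q.
  move=> p; apply: (@filter_ex _ \oo); apply: filterI; first by exists p.+1.
  apply: (@filter_forall _ _ _ \oo) => l.
  have [Il|nI] := pselect (I l = range iota).
    by apply: filterS (bdvg l Il (b l p).+1).
  by apply: filterS filterT => q _ /nI.
pose u n := iter n next 0.
have ltu : {homo u : n p / n < p >-> lt_all n p}.
  apply: homo_ltn => [q p r [pq bpq] [qr bqr]|n]; last exact: nextP.
  split; first exact: ltn_trans pq qr.
  by move=> l Il; exact: ltn_trans (bpq l Il) (bqr l Il).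
exists (fun l n => a l (u n)); split.
- move=> l l' n p ne; apply: inja => -[el]; rewrite -{}el in ne *.
  have [/ltu[]|/ltu[]|enp] := ltngtP n p; last by rewrite enp in ne.
  + by move=> lt _ e; rewrite e ltnn in lt.
  + by move=> lt _ e; rewrite e ltnn in lt.
- move=> l Il; exists (b l \o u); split=> [n p /ltu[_]|n]; first exact.
  exact: bE.
- by apply: sequences_in_sub aX => n p /ltu[].
Qed.
End Sequences.

Theorem theorem6p1 (T : Type) (k m : nat)
    (Phi : set ('I_k.+1 -> 'I_m.+1))
    (Phi_nonempty : Phi !=set0)
    (Phi_onto : forall phi, Phi phi -> forall l, exists s, phi s = l)
    (I : 'I_m.+1 -> set T)
    (I_infinite : forall l, infinite_set (I l))
    (X : forall phi : 'I_k.+1 -> 'I_m.+1, set (nprod (fun s => I (phi s)))) :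
  ((exists U : forall l, set_system (I l),
      [/\ forall l, UltraFilter (U l),
          forall l, nonprincipal (U l),
          forall l l', l <> l' -> as_family (U l) <> as_family (U l') &
          forall phi, Phi phi -> ntensor (fun s => U (phi s)) (X phi)])
   <->
   (exists a : forall l, nat -> I l,
      disjoint_injective a /\ sequences_in Phi X a))
  /\
  (forall iota : nat -> T, injective iota ->
   (exists a : forall l, nat -> I l,
      disjoint_injective a /\ sequences_in Phi X a) ->
   (exists a : forall l, nat -> I l,
      [/\ disjoint_injective a, increasing_on_nat iota a &
          sequences_in Phi X a])).
Proof.
split; [split|].
- move=> [U [UU npU _ UX]].
  exact: ultrafilters_sequences UU npU UX.
- move=> [a [inja aX]]; exact: sequences_ultrafilters inja aX.
- move=> iota _ [a [inja aX]].
  exact: increasing_subsequences inja aX.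
Qed.
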